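(* Let $\tilde K\in\mathbb{R}^{n_u\times n_x}$ and $\tilde P=\tilde P^\top\in\mathbb{R}^{n_x\times n_x}$ with $\tilde P\succ 0$ be such that $(K,P)=(\tilde K,\tilde P)$ satisfies $$\mathcal{H}\left(P{\boldsymbol{\delta}^*}^\top\begin{bmatrix}I\\ K\end{bmatrix}\right)+PP+\begin{bmatrix}I\\ K\end{bmatrix}^\top{\mathbf{A}^*}^{-1}\begin{bmatrix}I\\ K\end{bmatrix}\prec 0.\qquad (\mathrm{S})$$ Consider the optimization problem in the variables $K\in\mathbb{R}^{n_u\times n_x}$ and symmetric $P\in\mathbb{R}^{n_x\times n_x}$: $$(\mathrm{R})\quad \min_{K,P}\ \|K\circ I_{S^c}\|_F^2\quad\text{subject to } P\succ 0 \text{ and}$$ $$\begin{bmatrix}-\frac12 L(K,P|\tilde K,\tilde P)&\frac{1}{\sqrt2}\left(\boldsymbol{\delta}^*P+\begin{bmatrix}I\\ K\end{bmatrix}\right)^\top&\begin{bmatrix}I\\ K\end{bmatrix}^\top&P\\ \frac{1}{\sqrt2}\left(\boldsymbol{\delta}^*P+\begin{bmatrix}I\\ K\end{bmatrix}\right)&-I&0&0\\ \begin{bmatrix}I\\ K\end{bmatrix}&0&-\mathbf{A}^*&0\\ P&0&0&-I\end{bmatrix}\prec 0 .$$ Then Problem $(\mathrm{R})$ is feasible, and any optimal solution $(K^*,P^* )$ of $(\mathrm{R})$ is feasible for $(\mathrm{S})$ (that is, $P^*\succ0$ and $(K,P)=(K^*,P^* )$ satisfies $(\mathrm{S})$). Moreover,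 $\|K^*\circ I_{S^c}\|_F^2\le\|\tilde K\circ I_{S^c}\|_F^2$.
   Context: Notation: $\mathcal{H}(X)=X+X^\top$; $\circ$ is the elementwise product; $\|\cdot\|_F$ is the Frobenius norm; $M\succ0$ ($\succeq 0$, $\prec 0$, $\preceq 0$) means symmetric positive definite (positive semidefinite, negative definite, negative semidefinite); $I$ and $0$ are identity and zero matrices of appropriate size. In $\begin{bmatrix}I\\ K\end{bmatrix}\in\mathbb{R}^{(n_x+n_u)\times n_x}$ the identity is $n_x\times n_x$. Structure: $S\subseteq\mathbb{R}^{n_u\times n_x}$ is the linear subspace of matrices with a prescribed sparsity pattern. $I_S$ is the $0/1$ matrix with $[I_S]_{ij}=0$ if $K_{ij}=0$ is required and $[I_S]_{ij}=1$ if $K_{ij}$ is free. $I_{S^c}=\mathbf{1}_{n_u\times n_x}-I_S$, where $\mathbf{1}$ is the all-one matrix. Thus $K\in S$ iff $K\circ I_{S^c}=0$. Data: samples $x(t_i)\in\mathbb{R}^{n_x}$, $u(t_i)\in\mathbb{R}^{n_u}$, $\dot x(t_i)\in\mathbb{R}^{n_x}$, $i=0,\dots,T-1$, are collected from $\dot x(t)=Ax(t)+Bu(t)+Gd(t)$ with $(A,B)$ unknown and stabilizable, $G\in\mathbb{R}^{n_x\times n_d}$, and $\|d(t)\|_2\le\epsilon$ for all $t>0$ and some $\epsilon>0$. Define $$c_i=\dot x(t_i)\dot x(t_i)^\top-\epsilon^2GG^\top,\quad b_i=-\begin{bmatrix}x(t_i)\\ u(t_i)\end{bmatrix}\dot x(t_i)^\top,\quad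 a_i=\begin{bmatrix}x(t_i)\\ u(t_i)\end{bmatrix}\begin{bmatrix}x(t_i)\\ u(t_i)\end{bmatrix}^\top.$$ The matrices $\mathbf{A}^*\in\mathbb{R}^{(n_x+n_u)\times(n_x+n_u)}$ (symmetric, $\mathbf{A}^*\succ0$) and $\mathbf{B}^*\in\mathbb{R}^{(n_x+n_u)\times n_x}$ are a solution $(\mathbf{A},\mathbf{B})$ of $$\min_{\mathbf{A},\mathbf{B},\theta_0,\dots,\theta_{T-1}}-\log\det(\mathbf{A})\ \text{ s.t. }\ \begin{bmatrix}-I&\mathbf{B}^\top&\mathbf{B}^\top\\ \mathbf{B}&\mathbf{A}&0\\ \mathbf{B}&0&-\mathbf{A}\end{bmatrix}-\begin{bmatrix}\sum_{i=0}^{T-1}\theta_i\begin{bmatrix}c_i&b_i^\top\\ b_i&a_i\end{bmatrix}&0\\ 0&0\end{bmatrix}\preceq0,\ \mathbf{A}\succ0,\ \theta_i\ge0\ (i=0,\dots,T-1),$$ and $\boldsymbol{\delta}^*=-{\mathbf{A}^*}^{-1}\mathbf{B}^*\in\mathbb{R}^{(n_x+n_u)\times n_x}$. Linearization: for given $\tilde K,\tilde P$, $$L(K,P|\tilde K,\tilde P)=\left(\boldsymbol{\delta}^*\tilde P-\begin{bmatrix}I\\ \tilde K\end{bmatrix}\right)^\top\left(\boldsymbol{\delta}^*\tilde P-\begin{bmatrix}I\\ \tilde K\end{bmatrix}\right)+\mathcal{H}\left(\left(\boldsymbol{\delta}^*\tilde P-\begin{bmatrix}I\\ \tilde K\end{bmatrix}\right)^\top\left(\boldsymbol{\delta}^*(P-\tilde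 P)-\begin{bmatrix}0\\ K-\tilde K\end{bmatrix}\right)\right).$$ *)

(* Defs.v *)
From HB Require Import structures.
From mathcomp Require Import all_boot all_order all_algebra.
From mathcomp Require Import complex.
From mathcomp Require Import boolp classical_sets reals topology normedtype.
From mathcomp Require Import derive exp.

Set Implicit Arguments.
Unset Strict Implicit.
Unset Printing Implicit Defensive.

Import Order.TTheory GRing.Theory Num.Theory.
Import numFieldNormedType.Exports.

Local Open Scope ring_scope.

(* Definiteness includes symmetry. *)
Definition posdef (R : realType) (n : nat) (M : 'M[R]_n) : Prop :=
  M^T = M /\ forall v : 'cV[R]_n, v != 0 -> 0 < (v^T *m M *m v) 0 0.

Definition negdef (R : realType) (n : nat) (M : 'M[R]_n) : Prop :=
  M^T = M /\ forall v : 'cV[R]_n, v != 0 -> (v^T *m M *m v) 0 0 < 0.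

Definition negsemidef (R : realType) (n : nat) (M : 'M[R]_n) : Prop :=
  M^T = M /\ forall v : 'cV[R]_n, (v^T *m M *m v) 0 0 <= 0.

Definition Hsym (R : realType) (n : nat) (X : 'M[R]_n) : 'M[R]_n := X + X^T.

Definition hadamard (R : realType) (m n : nat) (M N : 'M[R]_(m, n)) :
    'M[R]_(m, n) :=
  map2_mx *%R M N.

Definition frobenius (R : realType) (m n : nat) (M : 'M[R]_(m, n)) : R :=
  Num.sqrt (\sum_i \sum_j M i j ^+ 2).

(* The library norm `|v| on matrices is the max norm. *)
Definition norm2 (R : realType) (n : nat) (v : 'cV[R]_n) : R :=
  Num.sqrt (\sum_i v i 0 ^+ 2).

Definition hurwitz (R : realType) (n : nat) (M : 'M[R]_n) : Prop :=
  forall z : R[i], eigenvalue (map_mx (real_complex R) M) z -> complex.Re z < 0.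

Definition stabilizable (R : realType) (nx nu : nat)
    (A : 'M[R]_nx) (B : 'M[R]_(nx, nu)) : Prop :=
  exists K : 'M[R]_(nu, nx), hurwitz (A + B *m K).

(* A sparsity pattern is given by the set [free] of positions at which entries
   are unconstrained; [mask_compl] is the indicator of the positions that are
   required to be zero. *)
Definition mask (R : realType) (nu nx : nat) (free : {set 'I_nu * 'I_nx}) :
    'M[R]_(nu, nx) :=
  \matrix_(i, j) ((i, j) \in free)%:R.

Definition mask_compl (R : realType) (nu nx : nat)
    (free : {set 'I_nu * 'I_nx}) : 'M[R]_(nu, nx) :=
  const_mx 1 - mask R free.

Definition data_c (R : realType) (nx nd : nat) (eps : R)
    (G : 'M[R]_(nx, nd)) (xdot : 'cV[R]_nx) : 'M[R]_nx :=
  xdot *m xdot^T - eps ^+ 2 *: (G *m G^T).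

Definition data_b (R : realType) (nx nu : nat)
    (x : 'cV[R]_nx) (u : 'cV[R]_nu) (xdot : 'cV[R]_nx) : 'M[R]_(nx + nu, nx) :=
  - (col_mx x u *m xdot^T).

Definition data_a (R : realType) (nx nu : nat)
    (x : 'cV[R]_nx) (u : 'cV[R]_nu) : 'M[R]_(nx + nu) :=
  col_mx x u *m (col_mx x u)^T.

Definition data_block (R : realType) (nx nu nd : nat) (eps : R)
    (G : 'M[R]_(nx, nd)) (x : 'cV[R]_nx) (u : 'cV[R]_nu) (xdot : 'cV[R]_nx) :
    'M[R]_(nx + (nx + nu)) :=
  block_mx (data_c eps G xdot) (data_b x u xdot)^T
           (data_b x u xdot)   (data_a x u).

Definition ellipsoid_lmi (R : realType) (nx nu nd T : nat) (eps : R)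
    (G : 'M[R]_(nx, nd)) (xs : 'I_T -> 'cV[R]_nx) (us : 'I_T -> 'cV[R]_nu)
    (xdots : 'I_T -> 'cV[R]_nx)
    (A : 'M[R]_(nx + nu)) (B : 'M[R]_(nx + nu, nx)) (theta : 'I_T -> R) :
    'M[R]_(nx + (nx + nu) + (nx + nu)) :=
  col_mx (col_mx (row_mx (row_mx (- 1%:M) B^T) B^T)
                 (row_mx (row_mx B        A  ) 0))
                 (row_mx (row_mx B        0  ) (- A))
  - block_mx (\sum_(i < T) theta i *: data_block eps G (xs i) (us i) (xdots i)) 0
             0 0.

Definition ellipsoid_feasible (R : realType) (nx nu nd T : nat) (eps : R)
    (G : 'M[R]_(nx, nd)) (xs : 'I_T -> 'cV[R]_nx) (us : 'I_T -> 'cV[R]_nu)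
    (xdots : 'I_T -> 'cV[R]_nx)
    (A : 'M[R]_(nx + nu)) (B : 'M[R]_(nx + nu, nx)) (theta : 'I_T -> R) : Prop :=
  [/\ negsemidef (ellipsoid_lmi eps G xs us xdots A B theta),
      posdef A
    & forall i, 0 <= theta i].

Definition ellipsoid_solution (R : realType) (nx nu nd T : nat) (eps : R)
    (G : 'M[R]_(nx, nd)) (xs : 'I_T -> 'cV[R]_nx) (us : 'I_T -> 'cV[R]_nu)
    (xdots : 'I_T -> 'cV[R]_nx)
    (A : 'M[R]_(nx + nu)) (B : 'M[R]_(nx + nu, nx)) : Prop :=
  exists theta : 'I_T -> R,
    ellipsoid_feasible eps G xs us xdots A B theta /\
    forall A' B' theta', ellipsoid_feasible eps G xs us xdots A' B' theta' ->
      - ln (\det A) <= - ln (\det A').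

Definition delta_of (R : realType) (nx nu : nat)
    (A : 'M[R]_(nx + nu)) (B : 'M[R]_(nx + nu, nx)) : 'M[R]_(nx + nu, nx) :=
  - (invmx A *m B).

Definition IK (R : realType) (nx nu : nat) (K : 'M[R]_(nu, nx)) :
    'M[R]_(nx + nu, nx) :=
  col_mx 1%:M K.

Definition S_lhs (R : realType) (nx nu : nat)
    (A : 'M[R]_(nx + nu)) (delta : 'M[R]_(nx + nu, nx))
    (K : 'M[R]_(nu, nx)) (P : 'M[R]_nx) : 'M[R]_nx :=
  Hsym (P *m delta^T *m IK K) + P *m P + (IK K)^T *m invmx A *m IK K.

Definition S_feasible (R : realType) (nx nu : nat)
    (A : 'M[R]_(nx + nu)) (delta : 'M[R]_(nx + nu, nx))
    (K : 'M[R]_(nu, nx)) (P : 'M[R]_nx) : Prop :=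
  posdef P /\ negdef (S_lhs A delta K P).

(* Linearization at (Kt, Pt) of (delta P - [I; K])^T (delta P - [I; K]). *)
Definition Llin (R : realType) (nx nu : nat) (delta : 'M[R]_(nx + nu, nx))
    (Kt : 'M[R]_(nu, nx)) (Pt : 'M[R]_nx)
    (K : 'M[R]_(nu, nx)) (P : 'M[R]_nx) : 'M[R]_nx :=
  (delta *m Pt - IK Kt)^T *m (delta *m Pt - IK Kt)
  + Hsym ((delta *m Pt - IK Kt)^T
          *m (delta *m (P - Pt) - col_mx 0 (K - Kt))).

Definition R_lmi (R : realType) (nx nu : nat)
    (A : 'M[R]_(nx + nu)) (delta : 'M[R]_(nx + nu, nx))
    (Kt : 'M[R]_(nu, nx)) (Pt : 'M[R]_nx)
    (K : 'M[R]_(nu, nx)) (P : 'M[R]_nx) :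
    'M[R]_(nx + ((nx + nu) + ((nx + nu) + nx))) :=
  let W := (Num.sqrt 2)^-1 *: (delta *m P + IK K) in
  col_mx (row_mx (- (2^-1 *: Llin delta Kt Pt K P))
                          (row_mx W^T       (row_mx (IK K)^T P)))
 (col_mx (row_mx W        (row_mx (- 1%:M)  (row_mx 0        0)))
 (col_mx (row_mx (IK K)   (row_mx 0         (row_mx (- A)    0)))
         (row_mx P        (row_mx 0         (row_mx 0        (- 1%:M)))))).

Definition R_feasible (R : realType) (nx nu : nat)
    (A : 'M[R]_(nx + nu)) (delta : 'M[R]_(nx + nu, nx))
    (Kt : 'M[R]_(nu, nx)) (Pt : 'M[R]_nx)
    (K : 'M[R]_(nu, nx)) (P : 'M[R]_nx) : Prop :=
  posdef P /\ negdef (R_lmi A delta Kt Pt K P).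

Definition sparsity_cost (R : realType) (nx nu : nat)
    (free : {set 'I_nu * 'I_nx}) (K : 'M[R]_(nu, nx)) : R :=
  frobenius (hadamard K (mask_compl R free)) ^+ 2.

Definition R_optimal (R : realType) (nx nu : nat)
    (free : {set 'I_nu * 'I_nx})
    (A : 'M[R]_(nx + nu)) (delta : 'M[R]_(nx + nu, nx))
    (Kt : 'M[R]_(nu, nx)) (Pt : 'M[R]_nx)
    (K : 'M[R]_(nu, nx)) (P : 'M[R]_nx) : Prop :=
  R_feasible A delta Kt Pt K P /\
  forall K' P', R_feasible A delta Kt Pt K' P' ->
    sparsity_cost free K <= sparsity_cost free K'.

(* Main.v *)
(* Completing squares gives, for symmetric P and with J = [I; K],
     H(P delta^T J) = 1/2 (delta P + J)^T (delta P + J)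
                      - 1/2 (delta P - J)^T (delta P - J),
   so (S) is a convex part minus a convex quadratic. The linearization L
   minorizes that quadratic, the gap being a Gram matrix vanishing at the
   linearization point. By a Schur complement, the constraint of (R) is (S)
   with the quadratic replaced by L: it implies (S), and coincides with (S) at
   the linearization point, which is therefore feasible for (R). *)
Require Import Defs.
From HB Require Import structures.
From mathcomp Require Import all_boot all_order all_algebra.
From mathcomp Require Import complex.
From mathcomp Require Import boolp classical_sets reals topology normedtype.
From mathcomp Require Import derive exp.
From mathcomp Require Import ring.

Set Implicit Arguments.
Unset Strict Implicit.
Unset Printing Implicit Defensive.

Import Order.TTheory GRing.Theory Num.Theory.
Import numFieldNormedType.Exports.

Local Open Scope ring_scope.

Section Definiteness.
Variable R : realType.

Lemma qf_add n (M N : 'M[R]_n) (v : 'cV[R]_n) :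
  (v^T *m (M + N) *m v) 0 0 = (v^T *m M *m v) 0 0 + (v^T *m N *m v) 0 0.
Proof. by rewrite mulmxDr mulmxDl mxE. Qed.

Lemma gram_ge0 m n (X : 'M[R]_(m, n)) (v : 'cV[R]_n) :
  0 <= (v^T *m (X^T *m X) *m v) 0 0.
Proof.
rewrite mulmxA -trmx_mul -mulmxA mxE sumr_ge0 // => i _.
by rewrite mxE -expr2 sqr_ge0.
Qed.

Lemma posdef1 n : posdef (1%:M : 'M[R]_n).
Proof.
split=> [|v v0]; first exact: trmx1.
have ge0 i : 0 <= v i 0 ^+ 2 by exact: sqr_ge0.
have vv : (v^T *m 1%:M *m v) 0 0 = \sum_i v i 0 ^+ 2.
  by rewrite mulmx1 mxE; apply: eq_bigr => i _; rewrite mxE expr2.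
rewrite vv lt_neqAle sumr_ge0 // andbT eq_sym; apply: contra v0.
rewrite psumr_eq0 // => /allP v_eq0; apply/eqP/matrixP => i j.
rewrite ord1 mxE; apply/eqP; rewrite -sqrf_eq0.
exact: (implyP (v_eq0 i (mem_index_enum i))).
Qed.

Lemma posdef_ge0 n (M : 'M[R]_n) (v : 'cV[R]_n) :
  posdef M -> 0 <= (v^T *m M *m v) 0 0.
Proof.
move=> [_ Mpos]; have [->|/Mpos/ltW//] := eqVneq v 0.
by rewrite mulmx0 mxE.
Qed.

(** If the determinant vanished, the transpose of a nonzero row vector in the left kernel would make
    the quadratic form zero. *)
Lemma posdef_unitmx n (M : 'M[R]_n) : posdef M -> M \in unitmx.
Proof.
move=> [_ Mpos]; rewrite unitmxE unitfE; apply/det0P => -[v v0 vM].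
have /Mpos : v^T != 0 by rewrite trmx_eq0.
by rewrite trmxK vM mul0mx mxE ltxx.
Qed.

Lemma posdef_block_diag m n (M : 'M[R]_m) (N : 'M[R]_n) :
  posdef M -> posdef N -> posdef (block_mx M 0 0 N).
Proof.
move=> Mpos Npos; split.
  by rewrite tr_block_mx !trmx0 Mpos.1 Npos.1.
move=> v; rewrite -[v]vsubmxK; move: (usubmx v) (dsubmx v) => a b.
rewrite col_mx_eq0 negb_and tr_col_mx mul_row_block mul_row_col.
rewrite !mulmx0 addr0 add0r [ltRHS]mxE => /orP[a0|b0].
  by rewrite ltr_wpDr ?posdef_ge0 // Mpos.2.
by rewrite ltr_wpDl ?posdef_ge0 // Npos.2.
Qed.

(* Z stands for E^-1 N, so that the inverse of a block matrix is never
   needed. *)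
Lemma negdef_schur m n (M : 'M[R]_m) (E : 'M[R]_n) (N Z : 'M[R]_(n, m)) :
  posdef E -> E *m Z = N ->
  negdef (block_mx M N^T N (- E)) <-> negdef (M + Z^T *m N).
Proof.
move=> Epos EZ; have ET := Epos.1.
have NT : N^T = Z^T *m E by rewrite -EZ trmx_mul ET.
have ZNT : (Z^T *m N)^T = Z^T *m N by rewrite trmx_mul trmxK NT -mulmxA EZ.
(* Completing the square in [c]: for fixed [a], the form is largest at [c = Z *m a], where it equals
   the form of the Schur complement. *)
have square (a : 'cV[R]_m) (c : 'cV[R]_n) :
    (col_mx a c)^T *m block_mx M N^T N (- E) *m col_mx a c
    = a^T *m (M + Z^T *m N) *m a
      + - ((c - Z *m a)^T *m E *m (c - Z *m a)).
  rewrite tr_col_mx mul_row_block mul_row_col NT -EZ.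
  rewrite !(linearB, linearD) /= trmx_mul.
  rewrite !(mulmxDl, mulmxDr, mulNmx, mulmxN, mulmxA).
  rewrite !opprD !opprK !addrA.
  set s1 := a^T *m M *m a; set s2 := c^T *m E *m Z *m a.
  set s3 := a^T *m Z^T *m E *m c; set s4 := c^T *m E *m c.
  set s5 := a^T *m Z^T *m E *m Z *m a.
  by apply/matrixP => i j; rewrite !mxE; ring.
split=> -[sym neg]; split.
- move: sym; rewrite tr_block_mx => /eq_block_mx[MT _ _ _].
  by rewrite linearD /= MT ZNT.
(* This choice of lower half makes the subtracted square vanish. *)
- move=> a a0; have /neg : col_mx a (Z *m a) != 0.
    by rewrite col_mx_eq0 negb_and a0.
  by rewrite square subrr mulmx0 oppr0 addr0.
- have MT : M^T = M.
    by move: sym; rewrite linearD /= ZNT; apply: addIr.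
  by rewrite tr_block_mx MT trmxK linearN /= ET.
- move=> v; rewrite -[v]vsubmxK; move: (usubmx v) (dsubmx v) => a c.
  rewrite square col_mx_eq0 => ac0.
  rewrite [ltLHS]mxE [X in _ + X]mxE subr_lt0.
  (* For [a = 0] the Schur term is zero; strictness then comes from [E], since [c] must be
     nonzero. *)
  have [a0|/neg lt0] := eqVneq a 0; last first.
    exact: lt_le_trans lt0 (posdef_ge0 _ Epos).
  move: ac0; rewrite a0 eqxx /= !mulmx0 subr0 mxE.
  exact: Epos.2.
Qed.

End Definiteness.

Section Convexification.
Variables (R : realType) (nx nu : nat).
Variables (A : 'M[R]_(nx + nu)) (delta : 'M[R]_(nx + nu, nx)).
Implicit Types (K : 'M[R]_(nu, nx)) (P : 'M[R]_nx).

Lemma Hsym_square_diff K P : P^T = P ->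
  Hsym (P *m delta^T *m IK K)
  = 2^-1 *: ((delta *m P + IK K)^T *m (delta *m P + IK K))
    - 2^-1 *: ((delta *m P - IK K)^T *m (delta *m P - IK K)).
Proof.
move=> PT; rewrite /Hsym !(linearB, linearD) /= !trmx_mul !trmxK PT.
rewrite !(mulmxDl, mulmxDr, mulNmx, mulmxN, mulmxA).
set s1 := P *m delta^T *m IK K; set s2 := (IK K)^T *m delta *m P.
set s3 := P *m delta^T *m delta *m P; set s4 := (IK K)^T *m IK K.
by apply/matrixP => i j; rewrite !mxE; field.
Qed.

(** The increment of [delta *m P - IK K] from the linearization point; the identity blocks cancel,
    hence the zero upper block. *)
Definition lin_step Kt Pt K P : 'M[R]_(nx + nu, nx) :=
  delta *m (P - Pt) - col_mx 0 (K - Kt).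

Lemma lin_step_diag K P : lin_step K P K P = 0.
Proof. by rewrite /lin_step !subrr mulmx0 col_mx0 subrr. Qed.

(** In the expansion of [(X + Y)^T *m (X + Y)], with [Y] the increment, [Llin] collects the terms of
    order at most one in [Y]; only [Y^T *m Y] remains. *)
Lemma Llin_gap Kt Pt K P :
  (delta *m P - IK K)^T *m (delta *m P - IK K)
  = Llin delta Kt Pt K P + (lin_step Kt Pt K P)^T *m lin_step Kt Pt K P.
Proof.
have -> : delta *m P - IK K = delta *m Pt - IK Kt + lin_step Kt Pt K P.
  have JJ : col_mx 0 (K - Kt) = IK K - IK Kt.
    by rewrite /IK opp_col_mx add_col_mx subrr.
  rewrite /lin_step JJ mulmxBr /IK.
  by apply/matrixP => i j; rewrite !mxE; ring.
rewrite /Llin /Hsym -/(lin_step Kt Pt K P).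
move: (delta *m Pt - IK Kt) (lin_step Kt Pt K P) => X Y.
rewrite trmx_mul trmxK [(X + Y)^T]linearD /= !(mulmxDl, mulmxDr).
by apply/matrixP => i j; rewrite !mxE; ring.
Qed.

(** The Schur complement of the upper left block of [R_lmi], written as (S) plus half the
    linearization gap. *)
Definition R_schur Kt Pt K P : 'M[R]_nx :=
  S_lhs A delta K P
  + 2^-1 *: ((lin_step Kt Pt K P)^T *m lin_step Kt Pt K P).

Lemma negdef_R_lmi Kt Pt K P : posdef A -> P^T = P ->
  negdef (R_lmi A delta Kt Pt K P) <-> negdef (R_schur Kt Pt K P).
Proof.
move=> Apos PT.
pose W := (Num.sqrt 2)^-1 *: (delta *m P + IK K).
pose N := col_mx W (col_mx (IK K) P).
(* [E] is block diagonal with identities around [A], so solving [E *m Z = N] changes only the middle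
   block of [N]. *)
pose Z := col_mx W (col_mx (invmx A *m IK K) P).
pose E := block_mx (1%:M : 'M[R]_(nx + nu)) 0 0 (block_mx A 0 0 (1%:M : 'M_nx)).
have Epos : posdef E.
  by apply: posdef_block_diag (posdef1 _ _) (posdef_block_diag Apos (posdef1 _ _)).
have EZ : E *m Z = N.
  rewrite /E /Z !mul_block_col !mul0mx !mul1mx !addr0 !add0r.
  by rewrite mulKVmx ?posdef_unitmx.
have -> : R_lmi A delta Kt Pt K P
    = block_mx (- (2^-1 *: Llin delta Kt Pt K P)) N^T N (- E).
  rewrite /R_lmi -/W /E !opp_block_mx !oppr0 /N !tr_col_mx PT.
  rewrite -[col_mx (row_mx (IK K) _) _]block_mxEv block_mxEh.
  rewrite -[col_mx (row_mx W _) _]block_mxEv block_mxEh.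
  by rewrite -[col_mx (row_mx 0 _) _]block_mxEv block_mxEh col_mx0 row_mx0.
rewrite (negdef_schur _ Epos EZ).
(* The two factors [(Num.sqrt 2)^-1] multiply to the weight one half of the convex square. *)
have WW : W^T *m W = 2^-1 *: ((delta *m P + IK K)^T *m (delta *m P + IK K)).
  rewrite /W [(_ *: _)^T]linearZ /= -scalemxAl -scalemxAr scalerA -invfM.
  by rewrite -expr2 sqr_sqrtr.
have ZN : Z^T *m N
    = 2^-1 *: ((delta *m P + IK K)^T *m (delta *m P + IK K))
      + ((IK K)^T *m invmx A *m IK K + P *m P).
  rewrite (tr_col_mx W) (tr_col_mx (invmx A *m _)) !mul_row_col trmx_mul.
  by rewrite trmx_inv Apos.1 PT WW.
(* The half gap added in [R_schur] cancels the one produced by expanding the concave square, leaving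
   minus half of [Llin]. *)
rewrite ZN /R_schur /S_lhs Hsym_square_diff // (Llin_gap Kt Pt).
move: (P *m P) ((IK K)^T *m invmx A *m IK K) => s1 s2.
move: (Llin _ _ _ _ _) (_^T *m lin_step _ _ _ _) => s3 s4.
move: (_ *m (delta *m P + _)) => s5.
set lhs := - _ + _; set rhs := _ + _; suff -> : lhs = rhs by [].
by rewrite /lhs /rhs; apply/matrixP => i j; rewrite !mxE; ring.
Qed.

(** The left side of (S) is [R_schur] minus half a Gram matrix, so its quadratic form is no
    larger. *)
Lemma R_feasible_S_feasible Kt Pt K P :
  posdef A -> R_feasible A delta Kt Pt K P -> S_feasible A delta K P.
Proof.
move=> Apos [Ppos /(negdef_R_lmi _ _ _ Apos Ppos.1)[sym neg]]; split=> //.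
set Y := lin_step Kt Pt K P in sym neg *.
have gramT : (2^-1 *: (Y^T *m Y))^T = 2^-1 *: (Y^T *m Y).
  by rewrite linearZ /= trmx_mul trmxK.
split; first by move: sym; rewrite linearD /= gramT; apply: addIr.
move=> v /neg; apply: le_lt_trans; rewrite [leRHS]qf_add lerDl.
by rewrite -scalemxAr -scalemxAl mxE mulr_ge0 ?gram_ge0 // invr_ge0.
Qed.

(** At the linearization point the increment is zero, so [R_schur] reduces to the left side of
    (S). *)
Lemma S_feasible_R_feasible K P :
  posdef A -> S_feasible A delta K P -> R_feasible A delta K P K P.
Proof.
move=> Apos [Ppos Sneg]; split=> //.
apply/(negdef_R_lmi _ _ _ Apos Ppos.1).
by rewrite /R_schur lin_step_diag mulmx0 scaler0 addr0.
Qed.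

End Convexification.

Theorem theorem1 (R : realType) (nx nu nd T : nat)
  (free : {set 'I_nu * 'I_nx})
  (A : 'M[R]_nx) (B : 'M[R]_(nx, nu)) (G : 'M[R]_(nx, nd)) (eps : R)
  (x : R -> 'cV[R]_nx) (u : R -> 'cV[R]_nu) (d : R -> 'cV[R]_nd)
  (t : 'I_T -> R)
  (AB_stab : stabilizable A B)
  (eps_gt0 : 0 < eps)
  (d_bound : forall s : R, 0 < s -> norm2 (d s) <= eps)
  (dynamics : forall s : R, 0 < s ->
     is_derive s 1 x (A *m x s + B *m u s + G *m d s))
  (t_gt0 : forall i : 'I_T, 0 < t i)
  (As : 'M[R]_(nx + nu)) (Bs : 'M[R]_(nx + nu, nx))
  (AsBs_sol : ellipsoid_solution eps G
     (fun i => x (t i)) (fun i => u (t i)) (fun i => (x^`())%classic (t i)) As Bs)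
  (Kt : 'M[R]_(nu, nx)) (Pt : 'M[R]_nx)
  (Pt_posdef : posdef Pt)
  (KtPt_S : negdef (S_lhs As (delta_of As Bs) Kt Pt)) :
  (exists (K : 'M[R]_(nu, nx)) (P : 'M[R]_nx),
     R_feasible As (delta_of As Bs) Kt Pt K P) /\
  (forall (Ks : 'M[R]_(nu, nx)) (Ps : 'M[R]_nx),
     R_optimal free As (delta_of As Bs) Kt Pt Ks Ps ->
     S_feasible As (delta_of As Bs) Ks Ps /\
     frobenius (hadamard Ks (mask_compl R free)) ^+ 2
       <= frobenius (hadamard Kt (mask_compl R free)) ^+ 2).
Proof.
(* Positive definiteness of [As] is one of the constraints of the ellipsoid problem. *)
have [theta [[_ Apos _] _]] := AsBs_sol.
have feas : R_feasible As (delta_of As Bs) Kt Pt Kt Pt.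
  exact: S_feasible_R_feasible.
split=> [|Ks Ps [RKP opt]]; first by exists Kt, Pt.
(* The cost bound compares the optimum with the feasible point [Kt], [Pt]. *)
by split; [exact: R_feasible_S_feasible RKP | exact: opt feas].
Qed.
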